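(* Let $G$ be a finite group, $X$ a finite $G$-set, and $\mathbb{F}$ a field with $\mathrm{char}\,\mathbb{F}=0$ or $\gcd(\mathrm{char}\,\mathbb{F},|G|)=1$. Let $\mathbb{E}=\mathbb{F}(\omega)$ with $\omega$ a primitive $\exp(G)$-th root of unity, let $\widehat{X}$ be a $G$-dual set of $X$, and for $f\in\mathbb{F}^X\subseteq\mathbb{E}^X$ let $\widehat{f}\in\mathbb{E}^{\widehat{X}}$ be its Fourier transform. Let $\dim_{\mathbb{E}}\mathbb{E}G\widehat{f}$ be the $\mathbb{E}$-dimension of the $\mathbb{E}G$-submodule of $\mathbb{E}^{\widehat{X}}$ generated by $\widehat{f}$, and let $\dim_{\mathbb{F}}\mathbb{F}Gf$ be the $\mathbb{F}$-dimension of the $\mathbb{F}G$-submodule of $\mathbb{F}^X$ generated by $f$. Then for any $f\in\mathbb{F}^X$, $$\text{rk-supp}(\widehat{f}\,)=\dim_{\mathbb{E}}\mathbb{E}G\widehat{f}=\dim_{\mathbb{F}}\mathbb{F}Gf.$$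
   Context: $\exp(G)$ is the exponent of $G$. The field $\mathbb{E}$ is a splitting field for $G$. $\mathrm{Irr}(G)$ is the set of all absolutely irreducible characters of $G$ (over $\mathbb{E}$), and $n_\psi$ is the degree of $\psi\in\mathrm{Irr}(G)$. For each $\psi$ fix a matrix representation $\rho^\psi=(\rho^\psi_{ij}):G\to\mathrm{GL}_{n_\psi}(\mathbb{E})$ affording $\psi$. For a field $\mathbb{K}$, the space $\mathbb{K}^X$ of functions $X\to\mathbb{K}$ is a $\mathbb{K}G$-module via $(\alpha f)(x)=f(\alpha^{-1}x)$. $G$-dual set: decompose $\mathbb{E}^X=\bigoplus_{\psi}V^\psi$ into homogeneous components and $V^\psi=W^\psi_1\oplus\cdots\oplus W^\psi_{m_\psi}$ into irreducible submodules affording $\psi$ ($m_\psi\ge0$ is the multiplicity). Choose a basis $\lambda^\psi_{i1},\dots,\lambda^\psi_{in_\psi}$ of each $W^\psi_i$ such that $\alpha\lambda^\psi_{ij}=\sum_{k=1}^{n_\psi}\rho^\psi_{kj}(\alpha)\lambda^\psi_{ik}$ for all $\alpha\in G$, $1\le i\le m_\psi$, $1\le j\le n_\psi$. The set $\widehat{X}=\{\lambda^\psi_{ij}:\psi\in\mathrm{Irr}(G),1\le i\le m_\psi,1\le j\le n_\psi\}$, which is a basis of $\mathbb{E}^X$, is called a $G$-dual set of $X$. $\mathbb{E}^{\widehat{X}}$ is the space of functions $\widehat{X}\to\mathbb{E}$, made an $\mathbb{E}G$-module by $(\alpha h)(\lambda^\psi_{ij})=\sum_{k=1}^{n_\psi}h(\lambda^\psi_{ik})\rho^\psi_{kj}(\alpha^{-1})$.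 The Fourier transform of $f\in\mathbb{E}^X$ is $\widehat{f}\in\mathbb{E}^{\widehat{X}}$ given by $\widehat{f}(\lambda^\psi_{ij})=\sum_{x\in X}f(x)\lambda^\psi_{ij}(x)$. Write $\widehat{f}(\lambda^\psi)$ for the $m_\psi\times n_\psi$ matrix $(\widehat{f}(\lambda^\psi_{ij}))$. The rank support is the integer $\text{rk-supp}(\widehat{f}\,)=\sum_{\psi\in\mathrm{Irr}(G)}n_\psi\cdot\mathrm{rank}(\widehat{f}(\lambda^\psi))$. *)

(* Defs.v *)
From HB Require Import structures.
From mathcomp Require Import all_boot all_order all_fingroup all_algebra.
From mathcomp Require Import all_solvable all_field all_character.

Set Implicit Arguments.
Unset Strict Implicit.
Unset Printing Implicit Defensive.

Import GroupScope GRing.Theory.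
Local Open Scope ring_scope.

Section GSet.

Variables (gT : finGroupType) (G : {group gT}) (X : finType) (to : action G X).

(* MathComp actions are right actions; the left G-set structure is recovered
   by a . x = to x a^-1. *)
Definition lact (a : gT) (x : X) : X := to x a^-1%g.

(* K^X, over the regular module K^o so that it is a vectType over K. *)
Definition gfun (K : fieldType) := {ffun X -> K^o}.

Definition gfun_act (K : fieldType) (a : gT) (f : gfun K) : gfun K :=
  [ffun x => f (lact a^-1%g x)].

(* KGf *)
Definition gfun_submod (K : fieldType) (f : gfun K) : {vspace gfun K} :=
  <<[seq gfun_act a f | a in G]>>%VS.

End GSet.

Section Characters.

Variables (E : fieldType) (gT : finGroupType) (G : {group gT}).

(* A representation is only constrained on G, hence the domain subg_of G. *)
Definition repr_char n (rG : mx_representation E G n) : {ffun subg_of G -> E} :=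
  [ffun g => \tr (rG (sgval g))].

Definition abs_irr_char (psi : {ffun subg_of G -> E}) : Prop :=
  exists n, exists2 rG : mx_representation E G n,
    mx_absolutely_irreducible rG & repr_char rG = psi.

(* The finite set Irr(G), as a list without regard to repetitions, together
   with the chosen rho^psi. Absolute irreducibility of rho^psi is required
   explicitly: in positive characteristic it does not follow from the trace. *)
Record irr_system := IrrSystem {
  irr_chars : seq {ffun subg_of G -> E};
  irr_charsP : forall psi, psi \in irr_chars <-> abs_irr_char psi;
  irr_deg : seq_sub irr_chars -> nat;
  irr_rho : forall psi, mx_representation E G (irr_deg psi);
  irr_rho_irr : forall psi, mx_absolutely_irreducible (irr_rho psi);
  irr_rho_char : forall psi, repr_char (irr_rho psi) = val psi
}.

Definition Irr (S : irr_system) : finType := seq_sub (irr_chars S).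

End Characters.

Section DualSet.

Variables (E : fieldType) (gT : finGroupType) (G : {group gT}).
Variables (X : finType) (to : action G X).

Definition submodule (W : {vspace gfun X E}) : Prop :=
  forall a f, a \in G -> f \in W -> gfun_act to a f \in W.

Definition irr_submodule (W : {vspace gfun X E}) : Prop :=
  [/\ submodule W, W <> 0%VS
    & forall U : {vspace gfun X E},
        submodule U -> (U <= W)%VS -> U = 0%VS \/ U = W].

(* W has a basis on which G acts by a matrix representation of trace psi. *)
Definition submod_affords (W : {vspace gfun X E})
    (psi : {ffun subg_of G -> E}) : Prop :=
  exists n, exists (rG : mx_representation E G n) (b : n.-tuple (gfun X E)),
    [/\ basis_of W b,
        forall a, a \in G -> forall j : 'I_n,
          gfun_act to a (tnth b j) = \sum_(k < n) rG a k j *: tnth b k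
      & repr_char rG = psi].

(* V is the sum, i.e. the least upper bound, of all the irreducible submodules
   affording psi. *)
Definition homogeneous_component (psi : {ffun subg_of G -> E})
    (V : {vspace gfun X E}) : Prop :=
  (forall W, irr_submodule W -> submod_affords W psi -> (W <= V)%VS) /\
  (forall U, (forall W, irr_submodule W -> submod_affords W psi -> (W <= U)%VS)
    -> (V <= U)%VS).

Variable S : irr_system E G.

Record dual_set := DualSet {
  dual_mult : Irr S -> nat;
  dual_W : forall psi, 'I_(dual_mult psi) -> {vspace gfun X E};
  dual_V := fun psi => (\sum_(i < dual_mult psi) dual_W i)%VS;
  dual_V_hom : forall psi, homogeneous_component (val psi) (dual_V psi);
  dual_V_direct : directv (\sum_(psi : Irr S) dual_V psi)%VS;
  dual_V_full : (\sum_(psi : Irr S) dual_V psi = fullv)%VS;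
  dual_W_direct : forall psi, directv (\sum_(i < dual_mult psi) dual_W i)%VS;
  dual_W_irr : forall psi (i : 'I_(dual_mult psi)), irr_submodule (dual_W i);
  dual_W_affords : forall psi (i : 'I_(dual_mult psi)),
    submod_affords (dual_W i) (val psi);
  dual_lambda : forall psi, 'I_(dual_mult psi) -> 'I_(irr_deg psi) -> gfun X E;
  dual_lambda_basis : forall psi (i : 'I_(dual_mult psi)),
    basis_of (dual_W i) [seq dual_lambda i j | j : 'I_(irr_deg psi)];
  dual_lambda_act : forall psi (i : 'I_(dual_mult psi)) (j : 'I_(irr_deg psi)) a,
    a \in G ->
    gfun_act to a (dual_lambda i j) =
      \sum_(k < irr_deg psi) irr_rho psi a k j *: dual_lambda i k
}.

Variable D : dual_set.

(* The lambda^psi_ij are pairwise distinct (they form a basis), so the set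
   \hat X is represented by the type of its indices (psi, (i, j)). *)
Definition dual_index : finType :=
  {psi : Irr S & ('I_(dual_mult D psi) * 'I_(irr_deg psi))%type}.

Definition dual_idx psi (i : 'I_(dual_mult D psi)) (j : 'I_(irr_deg psi)) :
  dual_index := Tagged _ (i, j).

Definition dual_elt (l : dual_index) : gfun X E :=
  dual_lambda (tagged l).1 (tagged l).2.

Definition dual_fun := {ffun dual_index -> E^o}.

Definition dual_act (a : gT) (h : dual_fun) : dual_fun :=
  [ffun l : dual_index =>
    \sum_(k < irr_deg (tag l))
      h (dual_idx (tagged l).1 k) * irr_rho (tag l) a^-1%g k (tagged l).2].

(* EGh *)
Definition dual_submod (h : dual_fun) : {vspace dual_fun} :=
  <<[seq dual_act a h | a in G]>>%VS.

Definition fourier (f : gfun X E) : dual_fun :=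
  [ffun l => \sum_(x : X) f x * dual_elt l x].

Definition dual_mx (h : dual_fun) (psi : Irr S) :
    'M[E]_(dual_mult D psi, irr_deg psi) :=
  \matrix_(i, j) h (dual_idx i j).

Definition rk_supp (h : dual_fun) : nat :=
  (\sum_(psi : Irr S) irr_deg psi * \rank (dual_mx h psi))%N.

End DualSet.

(* The inclusion of F^X in E^X. *)
Definition gfun_ext (X : finType) (F : fieldType) (E : fieldExtType F)
  (f : gfun X F) : gfun X E := [ffun x => (f x)%:A].

(* Main.v *)
(* The Fourier transform pairs f with a basis of E^X and intertwines the two
   actions of G, so dim EGf^ = dim EGf; this equals dim FGf because a family free
   over F stays free over E. On the psi-block of E^(X^) an element a of G acts by
   right multiplication by rho^psi(a^-1). The rho^psi are absolutely irreducible
   and pairwise non-isomorphic, so the group algebra maps onto the product of the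
   full matrix algebras, and EGh is the direct sum of the spaces M_psi * Mat_n,
   each of dimension n_psi * rank M_psi, where M_psi is the psi-block of h. *)
Require Import Defs.
From HB Require Import structures.
From mathcomp Require Import all_boot all_order all_fingroup all_algebra.
From mathcomp Require Import all_solvable all_field all_character.

Set Implicit Arguments.
Unset Strict Implicit.
Unset Printing Implicit Defensive.

Import GroupScope GRing.Theory.
Local Open Scope ring_scope.

(* Wedderburn idempotents of the group ring separate the rho i. *)
Lemma abs_irr_simultaneous (E : fieldType) (gT : finGroupType) (G : {group gT})
    (sG : socleType (regular_repr E G)) (I : finType) (n : I -> nat)
    (rho : forall i, mx_representation E G (n i)) (A : forall i, 'M[E]_(n i)) :
    [pchar E]^'.-group G ->
    (forall i, mx_absolutely_irreducible (rho i)) ->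
    (forall i j, mx_rsim (rho i) (rho j) -> i = j) ->
  exists t : gT -> E, forall i, A i = \sum_(x in G) t x *: rho i x.
Proof.
move=> charE abs_irr rsim_inj.
have irr_rho i := mx_abs_irrW (abs_irr i).
pose w i := irr_comp sG (rho i).
have w_inj : injective w.
  move=> i j eq_w; apply: rsim_inj.
  apply: mx_rsim_trans (rsim_irr_comp_pchar sG charE (irr_rho i)) _.
  rewrite -/(w i) eq_w; apply: mx_rsim_sym.
  exact: rsim_irr_comp_pchar.
(* Absolute irreducibility makes the matrices [rho i x] span the full matrix algebra, so each [A i]
   is attained by [rho i] taken alone. *)
have [a aP] : exists a : I -> gT -> E,
    forall i, A i = \sum_(x in G) a i x *: rho i x.
  apply: (@fin_all_exists _ (fun=> gT -> E)
    (fun i b => A i = \sum_(x in G) b x *: rho i x)) => i.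
  have /mx_abs_irrP[_ [b bP]] := abs_irr i.
  by exists (b^~ (A i)).
pose B i := \sum_(x in G) a i x *: regular_repr E G x.
(* [rho i] sends [Wedderburn_id (w i)] to 1 and, as [w] is injective, [Wedderburn_id (w j)] to 0 for
   j distinct from i. So [C] maps to [A i] under all [rho i] at once, and its group ring
   coefficients serve as [t]. *)
pose C := \sum_i B i *m Wedderburn_id (w i).
have e_in j : (Wedderburn_id (sG := sG) j \in group_ring E G)%MS.
  rewrite -(Wedderburn_sum_pchar sG charE); apply: (sumsmx_sup j) => //.
  exact: Wedderburn_id_mem.
have /envelop_mxP[t tP] : (C \in group_ring E G)%MS.
  rewrite linear_sum summx_sub // => i _; apply: envelop_mxM => //.
  by apply/envelop_mxP; exists (a i).
have opE j (b : gT -> E) :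
    gring_op (rho j) (\sum_(x in G) b x *: regular_repr E G x)
      = \sum_(x in G) b x *: rho j x.
  by rewrite linear_sum; apply: eq_bigr => x Gx; rewrite linearZ /= gring_opG.
(* The idempotents sum to 1, and [rho i] kills all but the one at [w i]. *)
have op_e i : gring_op (rho i) (Wedderburn_id (w i)) = 1%:M.
  rewrite -(gring_op1 (rho i)) -(Wedderburn_sum_id_pchar sG charE).
  rewrite linear_sum (bigD1 (w i)) //= addrC big1 ?add0r // => j ne_j.
  exact: (irr_comp'_op0_pchar charE (irr_rho i) ne_j (Wedderburn_id_mem j)).
exists t => i; rewrite -opE -tP linear_sum (bigD1 i) //= big1 => [|j ne_ji].
  by rewrite gring_opM // op_e mulmx1 addr0 opE.
rewrite gring_opM //; set e := Wedderburn_id (w j).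
have -> : gring_op (rho i) e = 0; last by rewrite mulmx0.
apply: (irr_comp'_op0_pchar (j := w j) charE (irr_rho i)).
  by apply: contra ne_ji => /eqP/w_inj ->.
exact: Wedderburn_id_mem.
Qed.

Section FieldExtension.

Variables (X : finType) (F : fieldType) (E : fieldExtType F).

Lemma gfun_extD : {morph @gfun_ext X F E : f g / f + g}.
Proof. by move=> f g; apply/ffunP=> x; rewrite !ffunE scalerDl. Qed.

Lemma gfun_extZ c f :
  gfun_ext E (c *: f : gfun X F) = (c%:A : E) *: gfun_ext E f.
Proof. by apply/ffunP=> x; rewrite !ffunE -[RHS]scalerAl mul1r scalerA. Qed.

Lemma gfun_ext_sum n (c : 'I_n -> F) (f : 'I_n -> gfun X F) :
  gfun_ext E (\sum_i c i *: f i) = \sum_i ((c i)%:A : E) *: gfun_ext E (f i).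
Proof.
have e0 : gfun_ext E (0 : gfun X F) = 0.
  by apply/ffunP=> x; rewrite !ffunE scale0r.
rewrite (big_morph _ gfun_extD e0).
by apply: eq_bigr => i _; rewrite gfun_extZ.
Qed.

(** The values of [b] lie in F, so taking one coordinate in an F-basis of E turns a relation over E
    into a relation over F, which is trivial. *)
Lemma free_gfun_ext n (b : n.-tuple (gfun X F)) :
  free b -> free (map (@gfun_ext X F E) b).
Proof.
move=> /freeP free_b.
apply/(@freeP _ _ _ (map_tuple (@gfun_ext X F E) b)) => c c0 i.
have bE := vbasisP {:E}.
rewrite (coord_basis bE (memvf (c i))) big1 // => l _.
suffices -> : coord (vbasis {:E}) l (c i) = 0 by rewrite scale0r.
apply: (free_b (fun i => coord (vbasis {:E}) l (c i))).
apply/ffunP=> x; have /ffunP/(_ x) := c0; rewrite !sum_ffunE !ffunE.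
move/(congr1 (coord (vbasis {:E}) l)); rewrite linear0 linear_sum => h.
rewrite -[RHS]h; apply: eq_bigr => j _.
rewrite !ffunE (nth_map 0) ?size_tuple // ffunE.
rewrite -[c j *: _]/(c j * (b`_j x)%:A) mulr_algr.
by rewrite linearZ /= mulrC.
Qed.

Lemma dim_span_gfun_ext (s : seq (gfun X F)) :
  \dim <<map (@gfun_ext X F E) s>> = \dim <<s>>.
Proof.
set e := @gfun_ext X F E; set b := vbasis <<s>>.
have bP : basis_of <<s>> b := vbasisP _.
have sub (u v : seq (gfun X F)) :
    {subset u <= <<v>>%VS} -> (<<map e u>> <= <<map e v>>)%VS.
  move=> uv; apply/span_subvP => _ /mapP[f /uv fv ->].
  rewrite -[v]in_tupleE in fv; rewrite (coord_span fv) /e gfun_ext_sum.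
  apply: memv_suml => i _; apply/memvZ/memv_span/map_f.
  by rewrite mem_nth.
have -> : (<<map e s>> = <<map e b>>)%VS.
  apply/eqP; rewrite eqEsubv !sub // => f fin; rewrite ?(span_basis bP).
    exact: vbasis_mem.
  exact: memv_span.
have /eqP := free_gfun_ext (basis_free bP).
by rewrite size_map size_tuple.
Qed.

End FieldExtension.

Section Dual.

Variables (E : fieldType) (gT : finGroupType) (G : {group gT}).
Variables (X : finType) (to : action G X).
Variables (S : irr_system E G) (D : dual_set to S).

Lemma fourier_linear : linear (fourier D).
Proof.
move=> c f g; apply/ffunP=> l; rewrite !ffunE scaler_sumr -big_split /=.
by apply: eq_bigr => x _; rewrite !ffunE mulrDl -scalerAl.
Qed.

HB.instance Definition _ := GRing.isLinear.Build E _ _ _ (fourier D)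
  fourier_linear.

(* A function orthogonal to the basis of all lambdas is orthogonal to every delta
   function. *)
Lemma fourier_inj f : fourier D f = 0 -> f = 0.
Proof.
move=> f0.
(* Pairing with [f] is packaged as a linear form so that its kernel is a subspace; containing every
   [dual_W], it is everything. *)
pose p (g : gfun X E) : E^o := \sum_x f x * g x.
have p_lin : linear p.
  move=> c g h; rewrite /p scaler_sumr -big_split /=.
  by apply: eq_bigr => x _; rewrite !ffunE mulrDr -scalerAr.
pose pM := GRing.isLinear.Build E _ _ _ p p_lin.
pose pL : {linear gfun X E -> E^o} := HB.pack p pM.
suffices ker_p g : g \in lker (linfun pL).
  apply/ffunP=> x; have := ker_p [ffun y => (y == x)%:R].
  rewrite memv_ker lfunE /= /p (bigD1 x) //= !ffunE eqxx mulr1 big1 => [|y nyx].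
    by rewrite addr0 => /eqP.
  by rewrite ffunE (negPf nyx) mulr0.
have : (fullv <= lker (linfun pL))%VS; last by move/subvP; apply; exact: memvf.
rewrite -(dual_V_full D); apply/subv_sumP => psi _; apply/subv_sumP => i _.
rewrite -(span_basis (dual_lambda_basis i)); apply/span_subvP => _ /imageP[j _ ->].
rewrite memv_ker lfunE /= /p.
by have /ffunP/(_ (dual_idx i j)) := f0; rewrite !ffunE => ->.
Qed.

(** A change of variable in the sum over X moves [a] off [f] and turns it into [a^-1] acting on the
    lambdas, which [dual_lambda_act] expands. *)
Lemma fourier_act a f :
  a \in G -> fourier D (gfun_act to a f) = dual_act a (fourier D f).
Proof.
move=> Ga; apply/ffunP=> -[psi [i j]]; rewrite !ffunE /=.
pose b := a^-1%g; have Gb : b \in G by rewrite groupV.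
transitivity (\sum_x f x * gfun_act to b (dual_lambda i j) x).
  rewrite (reindex_inj (act_inj to a^-1%g)) /=.
  apply: eq_bigr => x _; rewrite !ffunE /lact /b invgK.
  congr (f _ * _); by rewrite -actMin ?mulVg ?act1.
rewrite (dual_lambda_act i j Gb).
transitivity (\sum_x \sum_k f x * (irr_rho psi b k j *: dual_lambda i k) x).
  by apply: eq_bigr => x _; rewrite sum_ffunE mulr_sumr.
rewrite exchange_big /=; apply: eq_bigr => k _; rewrite ffunE mulr_suml.
apply: eq_bigr => x _; rewrite ffunE /dual_elt /=.
by rewrite -mulrA; congr (_ * _); rewrite mulrC.
Qed.

Lemma dim_dual_submod_fourier f :
  \dim (dual_submod (fourier D f)) = \dim (gfun_submod to f).
Proof.
have <- : (linfun (fourier D) @: gfun_submod to f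
             = dual_submod (fourier D f))%VS.
  rewrite /gfun_submod limg_span -map_comp /dual_submod; congr <<_>>%VS.
  apply/eq_in_map => a; rewrite mem_enum => Ga.
  by rewrite /= lfunE /= fourier_act.
apply: limg_dim_eq; apply/eqP; rewrite -subv0; apply/subvP => g.
rewrite memv_cap memv_ker lfunE /= memv0 => /andP[_ /eqP g0].
by apply/eqP/fourier_inj.
Qed.

(** Similar representations have equal traces, and the elements of [Irr S] are themselves the
    characters. *)
Lemma irr_rho_rsim_inj (phi psi : Irr S) :
  mx_rsim (irr_rho phi) (irr_rho psi) -> phi = psi.
Proof.
move=> sim; apply: val_inj; rewrite -!irr_rho_char; apply/ffunP=> g.
by rewrite !ffunE; apply: mxtrace_rsim => //; apply: subgP.
Qed.

Lemma dual_mx_act a h psi :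
  dual_mx (dual_act a h) psi = dual_mx (D := D) h psi *m irr_rho psi a^-1%g.
Proof.
by apply/matrixP=> i j; rewrite !mxE ffunE; apply: eq_bigr => k _; rewrite !mxE.
Qed.

Lemma dual_mx_sum (t : gT -> E) (h : gT -> dual_fun D) psi :
  dual_mx (\sum_(x in G) t x *: h x) psi = \sum_(x in G) t x *: dual_mx (h x) psi.
Proof.
apply/matrixP=> i j; rewrite !mxE sum_ffunE summxE.
by apply: eq_bigr => x _; rewrite !mxE ffunE.
Qed.

Lemma dual_mx_inj (g h : dual_fun D) :
  (forall psi, dual_mx g psi = dual_mx h psi) -> g = h.
Proof.
move=> eq_gh; apply/ffunP=> -[psi [i j]].
by have /matrixP/(_ i j) := eq_gh psi; rewrite !mxE.
Qed.

(* EGh consists of the functions whose psi-blocks are col_base (dual_mx h psi)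
   times an arbitrary matrix. *)
Lemma dim_dual_submod (sG : socleType (regular_repr E G)) (h : dual_fun D) :
  [pchar E]^'.-group G -> \dim (dual_submod h) = rk_supp h.
Proof.
move=> charE; pose M := dual_mx h.
(* [I] indexes the entries of the arbitrary right factors, so its cardinality is the rank
   support. *)
pose I : finType := {psi : Irr S & ('I_(\rank (M psi)) * 'I_(irr_deg psi))%type}.
pose cmx (c : {ffun I -> E^o}) psi : 'M[E]_(\rank (M psi), irr_deg psi) :=
  \matrix_(i, j) c (Tagged _ (i, j)).
pose L (c : {ffun I -> E^o}) : dual_fun D :=
  [ffun l => (col_base (M (tag l)) *m cmx c (tag l)) (tagged l).1 (tagged l).2].
have LE c psi : dual_mx (L c) psi = col_base (M psi) *m cmx c psi.
  by apply/matrixP=> i j; rewrite mxE ffunE.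
have cmx_onto (C : forall psi, 'M[E]_(\rank (M psi), irr_deg psi)) :
    exists c, forall psi, cmx c psi = C psi.
  exists [ffun l : I => C (tag l) (tagged l).1 (tagged l).2] => psi.
  by apply/matrixP=> i j; rewrite mxE ffunE.
have L_lin : linear L.
  move=> c f g; apply/ffunP=> l; rewrite !ffunE !mxE scaler_sumr -big_split /=.
  by apply: eq_bigr => k _; rewrite !mxE !ffunE mulrDr; congr (_ + _); exact: mulrCA.
pose LM := GRing.isLinear.Build E _ _ _ L L_lin.
pose LL : {linear {ffun I -> E^o} -> dual_fun D} := HB.pack L LM.
have -> : dual_submod h = limg (linfun LL).
  apply/eqP; rewrite eqEsubv; apply/andP; split.
    apply/span_subvP => _ /imageP[a Ga ->].
    have [c cP] := cmx_onto (fun psi => row_base (M psi) *m irr_rho psi a^-1%g).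
    have -> : dual_act a h = linfun LL c; last by rewrite memv_img ?memvf.
    rewrite lfunE /=; apply: dual_mx_inj => psi.
    by rewrite LE cP mulmxA mulmx_base dual_mx_act.
  apply/subvP => _ /memv_imgP[c _ ->]; rewrite lfunE /=.
  (* [row_base (M psi)] has a right inverse, so multiplying [M psi] by this matrix gives the
     psi-block of [L c]. The group elements enter inverted below because [dual_act] uses [a^-1]. *)
  have [t tP] := abs_irr_simultaneous sG
    (fun psi => pinvmx (row_base (M psi)) *m cmx c psi) charE
    (@irr_rho_irr _ _ _ S) irr_rho_rsim_inj.
  have -> : L c = \sum_(x in G) t x *: dual_act x^-1%g h.
    apply: dual_mx_inj => psi; rewrite dual_mx_sum LE.
    under eq_bigr => x _ do rewrite dual_mx_act invgK scalemxAr.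
    rewrite -mulmx_sumr -tP -/(M psi); apply: esym.
    rewrite -[X in X *m _ = _]mulmx_base -mulmxA.
    by rewrite (mulmxA (row_base _)) mulmxVp ?row_base_free // mul1mx.
  apply: memv_suml => x Gx; apply/memvZ/memv_span.
  by apply/image_f; rewrite groupV.
rewrite limg_dim_eq; last first.
  apply/eqP; rewrite capfv -subv0; apply/subvP => c.
  rewrite memv_ker lfunE /= memv0 => /eqP Lc0; apply/eqP/ffunP=> -[psi [i j]].
  have : cmx c psi = 0.
    (* [col_base (M psi)] has full column rank; the transpose of [N] is a left inverse that cancels
       it. *)
    have /row_freeP[N NP] : row_free (col_base (M psi))^T.
      by rewrite /row_free mxrank_tr; exact: col_base_full.
    rewrite -[cmx c psi]mul1mx -trmx1 -NP trmx_mul trmxK -mulmxA -LE Lc0.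
    by apply/matrixP=> i' j'; rewrite !mxE big1 // => k _; rewrite !mxE ffunE mulr0.
  by move/matrixP/(_ i j); rewrite !mxE ffunE.
rewrite dimvf /dim /= muln1 card_tagged sumnE big_map big_enum /=.
by apply: eq_bigr => psi _; rewrite card_prod !card_ord mulnC.
Qed.

End Dual.

Theorem lemma2p9 (gT : finGroupType) (G : {group gT}) (X : finType)
    (to : action G X) (F : fieldType) (E : fieldExtType F) (omega : E)
    (charF : [pchar F]^'.-group G)
    (omega_prim : (exponent G).-primitive_root omega)
    (E_gen : <<1; omega>>%VS = fullv)
    (S : irr_system E G) (D : dual_set to S) (f : gfun X F) :
  rk_supp (fourier D (gfun_ext E f))
    = \dim (dual_submod (fourier D (gfun_ext E f))) /\
  \dim (dual_submod (fourier D (gfun_ext E f))) = \dim (gfun_submod to f).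
Proof.
split.
  (* [socle_exists] holds only classically, so the equality is first made boolean. *)
  apply/esym/eqP; apply: (socle_exists (regular_repr E G)) => sG.
  apply/eqP/(dim_dual_submod sG).
  (* E has the same characteristic as F. *)
  by rewrite /pgroup (eq_pnat _ (eq_negn (pchar_lalg E))).
rewrite dim_dual_submod_fourier -(dim_span_gfun_ext E) /gfun_submod -map_comp.
congr (\dim <<_>>); apply: eq_map => a; apply/ffunP=> x.
by rewrite !ffunE.
Qed.
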